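(* Let $q\in\{1,2\}$. Fix $\alpha\in(0,1)$, $\tau>0$, integers $n,N\ge1$, and a loss $\ell:\widehat{\mathcal Y}\times\mathcal Y\to\mathbb R_+$. Assume that either $|\mathcal X|=\infty$ or $|\mathcal Y|=\infty$, and that $\ell$ takes values in $[0,B]$. Let $\widehat T$ be a black-box test for algorithm evaluation, and assume that $\widehat T$ satisfies the stability-constrained validity condition $$\mathbb P_P\big(\widehat T(\mathcal A,\mathcal D_N)=1\big)\le\alpha\quad\text{for all algorithms }\mathcal A\text{ and distributions }P\text{ such that }\beta_q(\mathcal A,P,n)\le\gamma_q\text{ and }R_{P,n}(\mathcal A)\ge\tau,$$ for some stability parameter $\gamma_q\ge 2B/n^{1/q}$. Let $\tilde\tau=\tau\left(1+\frac{\alpha^{-1}-1}{N}\right)$. Then for any algorithm $\mathcal A$ and any distribution $P$ on $\mathcal X\times\mathcal Y$ with $\beta_q(\mathcal A,P,n)\le\gamma_q$, $R_{P,n}(\mathcal A)<\tau$, and $\tilde\tau<R_P^{\max}$, $$\mathbb P_P\big(\widehat T(\mathcal A,\mathcal D_N)=1\big)\le\left[\alpha\left(1+\frac{\tilde\tau-R_{P,n}(\mathcal A)}{R_P^{\max}-\tilde\tau}\right)^{N/n}\right]\wedge1 .$$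
   Context: $\mathcal X,\mathcal Y,\widehat{\mathcal Y}$ are measurable spaces; all functions are assumed measurable as appropriate, and singletons $\{(x,y)\}\subset\mathcal X\times\mathcal Y$ are measurable. $a\wedge b=\min(a,b)$; $[n]=\{1,\dots,n\}$. Algorithm: a map $\mathcal A:\bigcup_{m\ge0}(\mathcal X\times\mathcal Y)^m\times[0,1]\to\{\text{measurable functions }\mathcal X\to\widehat{\mathcal Y}\}$, taking a data set (a finite tuple of any size) and a random seed $\xi\in[0,1]$ and returning a fitted model $\mathcal A(\mathcal D;\xi)$; for each $m$ the map $((x_1,y_1),\dots,(x_m,y_m),\xi,x)\mapsto[\mathcal A(\{(x_i,y_i)\}_{i\in[m]};\xi)](x)$ is measurable. No symmetry in the data points is assumed. Risk: for measurable $f:\mathcal X\to\widehat{\mathcal Y}$, $R_P(f)=\mathbb E_P[\ell(f(X),Y)]$ with $(X,Y)\sim P$, and $R_P^{\max}=\sup_f R_P(f)$ over all such $f$. For an algorithm, $R_{P,n}(\mathcal A)=\mathbb E[\ell(\hat f_n(X_{n+1}),Y_{n+1})]$ where $\hat f_n=\mathcal A(\{(X_i,Y_i)\}_{i\in[n]};\xi)$, $(X_1,Y_1),\dots,(X_{n+1},Y_{n+1})$ are i.i.d. from $P$, and $\xi\sim\mathrm{Unif}[0,1]$ is independent of them. $\ell_q$-stability: with the same data and seed, and $\hat f_n^{-j}=\mathcal A(\{(X_i,Y_i)\}_{i\in[n]\setminus\{j\}};\xi)$, $$\beta_q(\mathcal A,P,n)=\max_{j=1,\dots,n}\mathbb E\left[\left|\ell(\hat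 f_n(X_{n+1}),Y_{n+1})-\ell(\hat f_n^{-j}(X_{n+1}),Y_{n+1})\right|^q\right]^{1/q}.$$ Data: $\mathcal D_N=\{(X_i,Y_i)\}_{i\in[N]}$ with $(X_i,Y_i)$ i.i.d. from $P$. $\mathbb P_P$ is over $\mathcal D_N$ and any randomization in $\widehat T$. Black-box test (algorithm evaluation): let $\mathfrak D=\bigcup_{m\ge0}(\mathcal X\times\mathcal Y)^m$. A function $\widehat T$ taking an algorithm $\mathcal A$ and a data set $\mathcal D\in\mathfrak D$ and returning a (possibly randomized) output $\widehat T(\mathcal A,\mathcal D)\in\{0,1\}$ is a black-box test if, for some functions $g^{(1)},g^{(2)},\dots,g$ (not depending on $\mathcal A$) and random seeds $\zeta^{(1)},\zeta^{(2)},\dots,\zeta$ i.i.d. $\mathrm{Unif}[0,1]$ (independent of the data), it is produced as follows. (1) At stage $r=1$, generate a data set in $\mathfrak D$ and a seed in $[0,1]$, $(\mathcal D^{(1)},\xi^{(1)})=g^{(1)}(\mathcal D,\zeta^{(1)})$, and compute $\hat f^{(1)}=\mathcal A(\mathcal D^{(1)};\xi^{(1)})$. (2) For each stage $r=2,3,\dots$, generate $(\mathcal D^{(r)},\xi^{(r)})=g^{(r)}\big(\mathcal D,(\mathcal D^{(s)})_{1\le s<r},(\hat f^{(s)})_{1\le s<r},(\zeta^{(s)})_{1\le s\le r},(\xi^{(s)})_{1\le s<r}\big)$ and compute $\hat f^{(r)}=\mathcal A(\mathcal D^{(r)};\xi^{(r)})$. (3) Repeat until some stopping criterion (evaluated on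 the information generated so far) is reached; $\hat r$ denotes the data-dependent total number of rounds, which is finite. (4) Return $\widehat T(\mathcal A,\mathcal D)=g\big(\mathcal D,(\mathcal D^{(r)})_{1\le r\le\hat r},(\hat f^{(r)})_{1\le r\le\hat r},(\zeta^{(r)})_{1\le r\le\hat r},(\xi^{(r)})_{1\le r\le\hat r},\zeta\big)$. The map $(\mathcal D,\zeta^{(1)},\zeta^{(2)},\dots,\zeta)\mapsto\widehat T(\mathcal A,\mathcal D)$ is assumed measurable. *)

(* Defs.v *)
From HB Require Import structures.
From mathcomp Require Import all_boot all_order all_algebra.
From mathcomp Require Import all_classical all_reals all_analysis.
Import Order.TTheory GRing.Theory Num.Theory.
Import numFieldNormedType.Exports.

Set Implicit Arguments.
Unset Strict Implicit.
Unset Printing Implicit Defensive.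

Local Open Scope classical_set_scope.
Local Open Scope ring_scope.

(* [0, 1] with its Borel sigma-algebra (the trace of that of R). *)
Definition unit_sub (R : realType) := {x : R | 0 <= x <= 1}.

Definition unit_sub0 (R : realType) : unit_sub R :=
  exist _ 0 (introT andP (conj (lexx 0) ler01)).

HB.instance Definition _ (R : realType) := Choice.on (unit_sub R).
HB.instance Definition _ (R : realType) :=
  isPointed.Build (unit_sub R) (unit_sub0 R).

Definition unit_val (R : realType) (x : unit_sub R) : R := sval x.

Definition unitI (R : realType) := g_sigma_algebra_preimageType (@unit_val R).

(* The default value 0 outside [0, 1] is immaterial: the uniform law on [0, 1],
   which lives on R in the library, gives that region mass 0. *)
Definition to_unitI (R : realType) (x : measurableTypeR R) : unitI R :=
  insubd (unit_sub0 R) x.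

Lemma measurable_to_unitI (R : realType) :
  measurable_fun [set: measurableTypeR R] (@to_unitI R).
Proof.
move=> _ _ [B mB <-]; rewrite !setTI.
have -> : @to_unitI R @^-1` (@unit_val R @^-1` B) =
    (fun x : R => if 0 <= x <= 1 then x else 0) @^-1` B.
  apply/seteqP; split => x /=; rewrite /unit_val /to_unitI;
    by rewrite -[sval _]/(val _) val_insubd.
rewrite -[X in measurable X]setTI.
suff : measurable_fun [set: measurableTypeR R]
    (fun x : R => if 0 <= x <= 1 then x else 0) by apply.
apply: measurable_fun_if => //=.
by apply: measurable_and => //; exact: measurable_realfun.measurable_fun_ler.
Qed.

HB.instance Definition _ (R : realType) :=
  isMeasurableFun.Build _ _ _ _ (@to_unitI R) (@measurable_to_unitI R).

Definition unif01 (R : realType) : probability (unitI R) R :=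
  distribution (uniform_prob (@ltr01 R)) (@to_unitI R).

(* Sequences in [0, 1] with the product sigma-algebra. *)
Definition seeds (R : realType) :=
  g_sigma_algebraType (\bigcup_(k : nat)
    preimage_set_system setT (fun s : nat -> unitI R => s k) measurable).

(* [Q] is the infinite product of the uniform law on [0, 1]: the values on
   cylinders determine it. *)
Definition iid_uniform (R : realType) (Q : probability (seeds R) R) :=
  forall (k : nat) (B : nat -> set (unitI R)), (forall i, measurable (B i)) ->
    Q [set s | forall i, (i < k)%N -> B i (s i)] =
    (\prod_(i < k) unif01 R (B i))%E.

Section iid_law.
Context d (T : measurableType d) (R : realType).

Definition tcons n (w : T * n.-tuple T) : n.+1.-tuple T :=
  [tuple of w.1 :: w.2].

Lemma measurable_tcons n : measurable_fun setT (@tcons n).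
Proof. exact: measurable_cons. Qed.

HB.instance Definition _ n :=
  isMeasurableFun.Build _ _ _ _ (@tcons n) (@measurable_tcons n).

Fixpoint iid_law (P : probability T R) n : probability (n.-tuple T) R :=
  match n with
  | 0 => \d_[tuple]
  | m.+1 => distribution (P \x iid_law P m)%E (@tcons m)
  end.

End iid_law.

Section algorithms.
Context dX dY dF (R : realType) (X : measurableType dX)
  (Y : measurableType dY) (Yhat : measurableType dF).

Record algorithm := Algorithm {
  fit :> seq (X * Y) -> unitI R -> {mfun X >-> Yhat};
  measurable_fit : forall m, measurable_fun setT
    (fun w : m.-tuple (X * Y) * unitI R * X => fit w.1.1 w.1.2 w.2) }.

Definition risk (l : Yhat -> Y -> R) (P : probability (X * Y)%type R)
    (f : {mfun X >-> Yhat}) : \bar R :=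
  'E_P[fun z => l (f z.1) z.2].

Definition max_risk (l : Yhat -> Y -> R) (P : probability (X * Y)%type R) :
    \bar R :=
  ereal_sup [set risk l P f | f in [set: {mfun X >-> Yhat}]].

(* Joint law of the training data, the test point and the seed. *)
Definition fit_law (P : probability (X * Y)%type R) n :
    probability (n.-tuple (X * Y) * (X * Y) * unitI R)%type R :=
  (iid_law P n \x P \x unif01 R)%E.

Definition alg_risk (l : Yhat -> Y -> R) (A : algorithm)
    (P : probability (X * Y)%type R) n : \bar R :=
  'E_(fit_law P n)[fun w => l (A w.1.1 w.2 w.1.2.1) w.1.2.2].

Definition leave_out n (D : n.-tuple (X * Y)) (j : 'I_n) : seq (X * Y) :=
  [seq tnth D i | i <- enum 'I_n & i != j].

(* The terms are nonnegative, so 0 is neutral for the maximum when 0 < n. *)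
Definition stability (l : Yhat -> Y -> R) (q : nat) (A : algorithm)
    (P : probability (X * Y)%type R) n : \bar R :=
  \big[Order.max/0%E]_(j < n)
    Lnorm (fit_law P n) q%:R%:E (fun w =>
      (l (A w.1.1 w.2 w.1.2.1) w.1.2.2 -
       l (A (leave_out w.1.1 j) w.2 w.1.2.1) w.1.2.2)%:E).

Record round := Round {
  round_data : seq (X * Y);
  round_model : {mfun X >-> Yhat};
  round_zeta : unitI R;
  round_xi : unitI R }.

(* The components of an algorithm-evaluating test. For r >= 1, [query r] picks
   the data set and seed on which the algorithm is run in round r, from the
   data, the chronological list of the earlier rounds and a fresh seed. *)
Record procedure := Procedure {
  query : nat -> seq (X * Y) -> seq round -> unitI R ->
          seq (X * Y) * unitI R;
  stop : seq (X * Y) -> seq round -> bool;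
  output : seq (X * Y) -> seq round -> unitI R -> bool }.

(* In a seed sequence [s], [s r] is the fresh seed of round r >= 1, while [s 0]
   is reserved for the output step (see [runs]). *)
Fixpoint history (b : procedure) (A : algorithm) (D : seq (X * Y))
    (s : seeds R) (r : nat) : seq round :=
  match r with
  | 0 => [::]
  | k.+1 => let h := history b A D s k in
            let Dxi := query b k.+1 D h (s k.+1) in
            rcons h (Round Dxi.1 (A Dxi.1 Dxi.2) (s k.+1) Dxi.2)
  end.

Definition runs (b : procedure)
    (T : algorithm -> seq (X * Y) -> seeds R -> bool) :=
  forall A D s, exists rhat : nat,
    [/\ (0 < rhat)%N,
        stop b D (history b A D s rhat),
        forall r, (0 < r < rhat)%N -> ~~ stop b D (history b A D s r) &
        T A D s = output b D (history b A D s rhat) (s 0%N)].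

(* No sigma-algebra is put on the space of models, so measurability is only
   required of the output. *)
Definition black_box_test
    (T : algorithm -> seq (X * Y) -> seeds R -> bool) :=
  (exists b, runs b T) /\
  forall A m, measurable_fun setT
    (fun w : m.-tuple (X * Y) * seeds R => T A w.1 w.2).

(* [Q] is the law of the seeds; the data are independent of them. *)
Definition prob_accept (Q : probability (seeds R) R)
    (T : algorithm -> seq (X * Y) -> seeds R -> bool)
    (A : algorithm) (P : probability (X * Y)%type R) N : \bar R :=
  (iid_law P N \x Q)%E
    [set w : N.-tuple (X * Y) * seeds R | T A w.1 w.2 = true].

End algorithms.

(* Main.v *)
Require Import Defs.
From HB Require Import structures.
From mathcomp Require Import all_boot all_order all_algebra.
From mathcomp Require Import all_classical all_reals all_analysis.
From mathcomp Require Import measurable_realfun ring lra.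
Import Order.TTheory GRing.Theory Num.Theory.
Import numFieldNormedType.Exports.

Set Implicit Arguments.
Unset Strict Implicit.
Unset Printing Implicit Defensive.

Local Open Scope classical_set_scope.
Local Open Scope ring_scope.

(** Call an algorithm [A] with data law [P] good if it satisfies the hypotheses
    of the last theorem: it is stable and its risk is below [tau]. The proof
    turns a good pair into one that is still stable but has risk at least
    [tau], and that a black-box test cannot tell apart from the original unless
    its data contain a special point.

    Fix a model [f] whose risk is nearly maximal, a marker [z] in [X * Y] and
    a number [s] in (0, 1). Change the data law into the mixture
    [s P + (1 - s) delta_z], and change the algorithm so that it returns [f]
    as soon as the marker occurs in its data. A sample of size [n] avoids the
    marker with probability close to [s ^+ n]. Hence the new risk, for the part
    of the test law that comes from [P], is about
    [s ^+ n * R(A) + (1 - s ^+ n) * R(f)], and a factor [s] accounts for the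
    test point itself (lemma [plant_risk_ge]). The price in
    stability comes from two rare events: the deleted data point is the only
    marked one, or the test point is the marker. It is covered by the lower
    bound on [gamma] (lemma [plant_loo_gap]).

    The test must therefore accept the new pair with probability at most
    [alpha]. But on samples without marker, whose law is [s ^+ N] times that of
    the original sample, the new algorithm differs from [A] only on data sets
    containing the marker, and the test would have to guess it. There are
    infinitely many points to choose the marker from, and every run of the test
    queries finitely many data sets: along an injective sequence of markers,
    each run is eventually the same for both algorithms (lemma
    [eventually_same_output]). In the limit the original acceptance
    probability [pr] satisfies [s ^+ N * pr <= alpha] (lemma [planted_power]).
    The same limit makes the mass that [P] itself puts on the marker
    negligible, so that atoms of [P] do no harm.

    It remains to choose [s]. With [tau'] and the maximal risk [RM] as in the
    theorem, every [s] with [s ^+ n < (RM - tau') / (RM - R(A))] makes the mixed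
    risk exceed [tau'] for a suitable [f], and the new risk exceeds [tau] if
    moreover [s * tau' >= tau]. In the opposite case Bernoulli's inequality
    gives [s ^+ N <= alpha] outright (lemma [expr_le_below_inflation]); this is where the
    inflation from [tau] to [tau'] comes from. Letting [s] increase to the
    [n]-th root of that quotient gives the bound. *)

(** * Elementary inequalities *)

Lemma bernoulli_ineq (R : realType) (y : R) k : -1 <= y ->
  1 + k%:R * y <= (1 + y) ^+ k.
Proof.
move=> y1; elim: k => [|k IH]; first by rewrite mul0r addr0 expr0.
have y0 : 0 <= 1 + y by lra.
rewrite -natr1 exprS; apply: le_trans (ler_wpM2l y0 IH).
have : 0 <= k%:R * (y * y) by rewrite mulr_ge0// -expr2 sqr_ge0.
lra.
Qed.

(** Each of the [m.+1] terms of the geometric sum [1 + s + ... + s ^+ m] is at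
    least [s ^+ m]. *)
Lemma one_minus_exp_ge (R : realType) (s : R) m : 0 <= s -> 0 <= 1 - s ->
  m.+1%:R * (1 - s) * s ^+ m <= 1 - s ^+ m.+1.
Proof.
move=> s0 s1; elim: m => [|m IH]; first by rewrite expr0 expr1 mul1r mulr1.
have sm0 : 0 <= s ^+ m by exact: exprn_ge0.
have sm1 : s * s ^+ m <= 1 by rewrite -exprS exprn_ile1//; lra.
move: IH; rewrite -[m.+2%:R]natr1 !exprS => /(ler_wpM2r s0).
have : 0 <= (1 - s) * (1 - s * s ^+ m) by apply: mulr_ge0 => //; lra.
by move: (s ^+ m) (m.+1%:R : R) => x k; lra.
Qed.

(** The hypothesis bounds [s] by the inverse of [1 + (alpha^-1 - 1) / N], whose
    [N]-th power is at least [alpha^-1] by Bernoulli's inequality. *)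
Lemma expr_le_below_inflation (R : realType) (alpha tau s : R) N :
  0 < alpha < 1 -> 0 < tau -> (1 <= N)%N -> 0 < s ->
  s * (tau * (1 + (alpha^-1 - 1) / N%:R)) < tau -> s ^+ N <= alpha.
Proof.
move=> /andP[a0 a1] t0 N1 s0.
have N0 : 0 < N%:R :> R by rewrite ltr0n.
have x0 : 0 < alpha^-1 - 1 by rewrite subr_gt0 invf_gt1.
set y := (alpha^-1 - 1) / N%:R; have y0 : 0 < y by rewrite divr_gt0.
rewrite mulrCA -[ltRHS]mulr1 ltr_pM2l// => sy.
have h1 : s ^+ N * (1 + y) ^+ N <= 1.
  rewrite -exprMn; apply: exprn_ile1; last exact: ltW.
  by apply: mulr_ge0; lra.
have h2 : alpha^-1 <= (1 + y) ^+ N.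
  apply: le_trans (bernoulli_ineq N (_ : -1 <= y)); last lra.
  by rewrite /y mulrC divfK ?gt_eqF// addrC subrK.
rewrite -[leRHS]mul1r -ler_pdivrMr//.
have sN0 : 0 < s ^+ N by exact: exprn_gt0.
exact: le_trans (ler_wpM2l (ltW sN0) h2) h1.
Qed.

(** Continuity of [s |-> s ^+ N * t] from the left at [c], made quantitative by
    Bernoulli's inequality. *)
Lemma le_exp_limit (R : realType) (c t a : R) N : 0 <= a -> 0 < c ->
  (forall s, 0 < s -> s < c -> s ^+ N * t <= a) -> c ^+ N * t <= a.
Proof.
move=> a0 c0 H; rewrite leNgt; apply/negP; set M := c ^+ N * t => aM.
have M0 : 0 < M by exact: le_lt_trans aM.
have N0 : 0 <= N%:R :> R by [].
have k0 : 0 < (N%:R + 2) * M by rewrite mulr_gt0// ltr_pwDr.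
(* Passing from [c] to [(1 - e) * c] costs at most [N * e * M], which is less
   than [M - a]. *)
pose e := (M - a) / ((N%:R + 2) * M).
have eE : e * ((N%:R + 2) * M) = M - a by rewrite divfK// gt_eqF.
have e0 : 0 < e by rewrite divr_gt0// subr_gt0.
have e1 : e < 1.
  rewrite ltr_pdivrMr// mul1r.
  have : 0 <= N%:R * M by rewrite mulr_ge0// ltW.
  lra.
have := H ((1 - e) * c); rewrite exprMn -mulrA -/M.
have sc0 : 0 < (1 - e) * c by rewrite mulr_gt0// subr_gt0.
have sc : (1 - e) * c < c by rewrite gtr_pMl// gtrBl.
move=> /(_ sc0 sc).
have := bernoulli_ineq N (_ : -1 <= - e); rewrite lerN2 => /(_ (ltW e1)).
move=> /(ler_wpM2r (ltW M0)) h1 h2.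
have : 0 < e * M by rewrite mulr_gt0.
lra.
Qed.

(** * Limits and integrals for probability measures *)

Section vanishing.
Context d (T : measurableType d) (R : realType).
Variable mu : {finite_measure set T -> \bar R}.

(** Every point lies in finitely many of the sets, so their limit superior is
    empty, and a finite measure is continuous from above. *)
Lemma measure_eventually_small (E : nat -> set T) :
  (forall k, measurable (E k)) ->
  (forall t, exists K, forall k, (K <= k)%N -> ~ E k t) ->
  forall e : R, 0 < e -> \forall k \near \oo, (mu (E k) <= e%:E)%E.
Proof.
move=> mE Efin e e0.
have E0 : lim_sup_set E = set0.
  rewrite -subset0 => t Et; have [K EK] := Efin t.
  by have [k /= Kk Ekt] := Et K I; exact: (EK k Kk).
have muoo : (mu (\bigcup_(k >= 0) E k) < +oo)%E.
  by rewrite ltey_eq fin_num_measure//; exact: bigcup_measurable.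
have := lim_sup_set_cvg mu E mE muoo.
rewrite E0 measure0 => /fine_cvgP [_ /cvgrPdist_le /(_ e e0)].
apply: filterS => k; rewrite sub0r normrN /= => ke.
have mU : measurable (\bigcup_(j >= k) E j) by exact: bigcup_measurable.
apply: (@le_trans _ _ (mu (\bigcup_(j >= k) E j))).
  by apply: le_measure; rewrite ?inE//; exact: (@bigcup_sup _ _ k _ _ (leqnn k)).
rewrite -(@fineK _ (mu (\bigcup_(j >= k) E j))) ?fin_num_measure//.
by rewrite lee_fin (le_trans (ler_norm _)).
Qed.
End vanishing.

Lemma integral_probability_cst d (T : measurableType d) (R : realType)
    (P : probability T R) (r : \bar R) : (\int[P]_x r = r)%E.
Proof.
transitivity (r * P [set: T])%E; first exact: integral_cst.
by rewrite probability_setT mule1.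
Qed.

Lemma integral_le_cst d (T : measurableType d) (R : realType)
    (P : probability T R) (h : T -> \bar R) (M : R) :
  measurable_fun [set: T] h -> (forall x, 0 <= h x)%E ->
  (forall x, h x <= M%:E)%E -> (\int[P]_x h x <= M%:E)%E.
Proof.
move=> mh h0 hM.
have M0 : 0 <= M by rewrite -lee_fin (le_trans (h0 point)).
rewrite -[leRHS](integral_probability_cst P).
by apply: ge0_le_integral => // x _; rewrite lee_fin.
Qed.

(** * Mixing a law with a point mass *)

Section contamination.
Context d (T : measurableType d) (R : realType).
Variables (P : probability T R) (z : T) (s : R).
Hypotheses (s0 : 0 <= s) (s1 : 0 <= 1 - s).

(** Huber's contamination model: with probability [1 - s] a draw from [P] is
    replaced by [z]. *)
Definition contamination : set T -> \bar R :=
  measure_add (mscale (NngNum s0) P) (mscale (NngNum s1) \d_z).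

HB.instance Definition _ := Measure.on contamination.

Lemma contaminationE A : contamination A = (s%:E * P A + (1 - s)%:E * \d_z A)%E.
Proof. by rewrite /contamination measure_addE. Qed.

Lemma contamination_setT : contamination setT = 1%E.
Proof.
by rewrite contaminationE probability_setT diracT !mule1 -EFinD addrC subrK.
Qed.

HB.instance Definition _ :=
  @Measure_isProbability.Build _ _ R contamination contamination_setT.

Lemma ge0_integral_contamination (f : T -> \bar R) :
  measurable_fun [set: _] f -> (forall x, 0 <= f x)%E ->
  (\int[contamination]_x f x = s%:E * \int[P]_x f x + (1 - s)%:E * f z)%E.
Proof.
move=> mf f0; rewrite ge0_integral_measure_add//.
by rewrite !ge0_integral_mscale//= integral_dirac// diracT mul1e.
Qed.
End contamination.

(** * Samples that avoid the marker *)

Section iid.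
Context d (T : measurableType d) (R : realType).
Implicit Type P : probability T R.

Lemma iid_lawS P n (E : set (n.+1.-tuple T)) :
  iid_law P n.+1 E =
  (\int[P]_x iid_law P n [set D : n.-tuple T | E [tuple of x :: D]])%E.
Proof.
apply: eq_integral => x _ /=; congr (iid_law P n _).
by apply/seteqP; split => D; rewrite /xsection /= inE.
Qed.

Lemma iid_law_box P n (B : 'I_n -> set T) : (forall i, measurable (B i)) ->
  iid_law P n [set D | forall i, B i (tnth D i)] = (\prod_(i < n) P (B i))%E.
Proof.
elim: n B => [|n IH] B mB.
  by rewrite big_ord0 /= diracE mem_set//= => -[].
rewrite iid_lawS.
under eq_integral => x _.
  have -> : iid_law P n [set D : n.-tuple T | forall i, B i (tnth [tuple of x :: D] i)] =
      ((\1_(B ord0) x)%:E * \prod_(i < n) P (B (lift ord0 i)))%E.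
    rewrite indicE; have [/set_mem xB|/negP xB] := boolP (x \in B ord0).
      rewrite mul1e -IH//; congr (iid_law P n _); apply/seteqP; split => D DB i.
        by have := DB (lift ord0 i); rewrite tnthS.
      by case: (unliftP ord0 i) => [j ->|->]; rewrite ?tnthS ?tnth0//; exact: DB.
    rewrite mul0e (_ : [set _ | _] = set0) ?measure0//.
    rewrite -subset0 => D /(_ ord0); rewrite tnth0 => ?; apply: xB; exact: mem_set.
  over.
rewrite ge0_integralZr//.
- by rewrite integral_indic// setIT big_ord_recl.
- by apply/measurable_EFinP; exact: measurable_indic.
- by apply: prode_ge0.
Qed.

Definition unmarked (z : T) n := [set D : n.-tuple T | z \notin D].

Arguments unmarked : clear implicits.

Lemma unmarkedE z n :
  unmarked z n = [set D : n.-tuple T | forall i, (~` [set z]) (tnth D i)].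
Proof.
apply/seteqP; split => D /=.
  by move=> zD i zi; move/negP: zD; apply; rewrite -zi mem_tnth.
by move=> zD; apply/negP => /tnthP [i zi]; apply: (zD i).
Qed.

Lemma measurable_box n (B : 'I_n -> set T) : (forall i, measurable (B i)) ->
  measurable [set D : n.-tuple T | forall i, B i (tnth D i)].
Proof.
move=> mB; rewrite (_ : [set _ | _] =
    \bigcap_(i in setT) ((fun D : n.-tuple T => tnth D i) @^-1` B i)).
  apply: fin_bigcap_measurable => // i _; rewrite -[X in measurable X]setTI.
  exact: measurable_tnth.
by apply/seteqP; split => [D DB i _|D DB i]; exact: DB.
Qed.

Lemma measurable_unmarked z n : measurable [set z] -> measurable (unmarked z n).
Proof.
move=> mz; rewrite unmarkedE.
by apply: (measurable_box (B := fun=> ~` [set z])) => _; exact: measurableC.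
Qed.

(** A sample without [z] can only arise if each of its [n] draws comes from the
    component [P]. This holds even if [z] is an atom of [P], as [E] is required
    to avoid [z]. *)
Lemma iid_contamination_unmarked P z (s : R) (s0 : 0 <= s) (s1 : 0 <= 1 - s) n
    (E : set (n.-tuple T)) : measurable [set z] ->
  measurable E -> E `<=` unmarked z n ->
  iid_law (contamination P z s0 s1) n E = ((s ^+ n)%:E * iid_law P n E)%E.
Proof.
move=> mz; elim: n E => [|n IH] E mE Ez.
  by rewrite /= expr0 mul1e.
have mF : measurable (@tcons _ T n @^-1` E).
  by rewrite -[X in measurable X]setTI; exact: measurable_tcons.
have mE' x : measurable [set D : n.-tuple T | E [tuple of x :: D]].
  rewrite (_ : [set _ | _] = xsection (@tcons _ T n @^-1` E) x).
    exact: measurable_xsection.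
  by apply/seteqP; split => D; rewrite /xsection /= inE.
have mI (Q : probability T R) : measurable_fun setT
    (fun x => iid_law Q n [set D : n.-tuple T | E [tuple of x :: D]]).
  rewrite (_ : (fun _ => _) = iid_law Q n \o xsection (@tcons _ T n @^-1` E)).
    exact: measurable_fun_xsection.
  apply/funext => x /=; congr (iid_law Q n _).
  by apply/seteqP; split => D; rewrite /xsection /= inE.
rewrite !iid_lawS ge0_integral_contamination//.
rewrite (_ : [set D : n.-tuple T | E [tuple of z :: D]] = set0); last first.
  by rewrite -subset0 => D /= /Ez /negP; apply; rewrite inE eqxx.
rewrite measure0 mule0 adde0.
rewrite exprS EFinM -muleA; congr (_ * _)%E.
rewrite -ge0_integralZl//; last by rewrite lee_fin exprn_ge0.
apply: eq_integral => x _; apply: IH => // D /Ez /=.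
by apply: contra => zD; rewrite inE zD orbT.
Qed.

Lemma integral_contamination_unmarked P z (s : R) (s0 : 0 <= s) (s1 : 0 <= 1 - s) n
    (f : n.-tuple T -> \bar R) : measurable [set z] ->
  measurable_fun [set: _] f -> (forall D, 0 <= f D)%E ->
  (\int[iid_law (contamination P z s0 s1) n]_(D in unmarked z n) f D =
   (s ^+ n)%:E * \int[iid_law P n]_(D in unmarked z n) f D)%E.
Proof.
move=> mz mf f0; have mU := measurable_unmarked (n := n) mz.
have sn0 : 0 <= s ^+ n by exact: exprn_ge0.
rewrite -(@ge0_integral_mscale _ _ _ _ _ mU (NngNum sn0))//; last first.
  exact: measurable_funTS.
apply: eq_measure_integral => A mA AU.
exact: iid_contamination_unmarked.
Qed.
End iid.
Arguments unmarked {d T} z n.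

(** The marked part is left under the contaminated law: there the planted
    algorithm ignores its data, so only the mass of that part will matter. *)
Lemma iid_contamination_split d (T : measurableType d) (R : realType)
    (P : probability T R) z (s : R) (s0 : 0 <= s) (s1 : 0 <= 1 - s) n
    (F : n.-tuple T -> \bar R) : measurable [set z] ->
  measurable_fun [set: n.-tuple T] F -> (forall D, 0 <= F D)%E ->
  (\int[iid_law (contamination P z s0 s1) n]_D F D =
   (s ^+ n)%:E * \int[iid_law P n]_(D in unmarked z n) F D +
   \int[iid_law (contamination P z s0 s1) n]_(D in ~` unmarked z n) F D)%E.
Proof.
move=> mz mF F0; have mU := measurable_unmarked (n := n) mz.
rewrite -integral_contamination_unmarked// -ge0_integral_setU//.
- by rewrite setUv.
- exact: measurableC.
- by rewrite setUv.
- by apply/disj_setPS => D [].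
Qed.

(** An event has at least the probability of its part on unmarked samples, where
    the two sample laws are proportional. *)
Lemma prod_contamination_ge d d' (T : measurableType d) (S : measurableType d')
    (R : realType) (P : probability T R) (Q : probability S R) z (s : R)
    (s0 : 0 <= s) (s1 : 0 <= 1 - s) n (E : set (n.-tuple T * S)) :
  measurable [set z] -> measurable E ->
  ((s ^+ n)%:E * (iid_law P n \x Q) (E `&` (unmarked z n `*` setT)) <=
   (iid_law (contamination P z s0 s1) n \x Q) E)%E.
Proof.
move=> mz mE; have mU := measurable_unmarked (n := n) mz.
pose g D := Q (xsection E D).
have mg : measurable_fun [set: n.-tuple T] g by exact: measurable_fun_xsection.
rewrite [leRHS](_ : _ = \int[iid_law (contamination P z s0 s1) n]_D g D)%E//.
rewrite iid_contamination_split//.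
rewrite [X in (_ * X)%E](_ : _ = \int[iid_law P n]_(D in unmarked z n) g D)%E.
  by rewrite leeDl// integral_ge0.
rewrite [RHS]integral_mkcond; apply: eq_integral => D _ /=.
rewrite patchE /g xsectionI; case: ifPn => DU.
  by rewrite in_xsectionX// setIT.
by rewrite notin_xsectionX// setI0 measure0.
Qed.

(** * Planting a model behind a marker *)

Section fitting.
Context dX dY dF (R : realType) (X : measurableType dX)
  (Y : measurableType dY) (Yhat : measurableType dF).
Implicit Types (A : algorithm R X Y Yhat) (P : probability (X * Y)%type R).
Notation fit_space n := (n.-tuple (X * Y) * (X * Y) * unitI R)%type.

(** The training sample [D] is kept fixed because the integrals below are
    computed by cases on whether [D] contains the marker. *)
Definition test_mean P n (h : fit_space n -> \bar R) (D : n.-tuple (X * Y)) :=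
  (\int[P]_w \int[unif01 R]_xi h (D, w, xi))%E.

Section test_mean.
Variables (n : nat) (h : fit_space n -> \bar R).
Hypotheses (mh : measurable_fun [set: fit_space n] h) (h0 : forall w, (0 <= h w)%E).

Let msection D w : measurable_fun [set: unitI R] (fun xi => h (D, w, xi)).
Proof. exact: (measurableT_comp mh (measurable_pair1 (D, w))). Qed.

Let mseed : measurable_fun [set: (n.-tuple (X * Y) * (X * Y))%type]
  (fun Dw => (\int[unif01 R]_xi h (Dw, xi))%E).
Proof. exact: measurable_fun_fubini_tonelli_F. Qed.

Let seed0 Dw : (0 <= \int[unif01 R]_xi h (Dw, xi))%E.
Proof. by apply: integral_ge0. Qed.

Let mseed_section D : measurable_fun [set: (X * Y)%type]
  (fun w => (\int[unif01 R]_xi h (D, w, xi))%E).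
Proof. exact: (measurableT_comp mseed (measurable_pair1 D)). Qed.

Lemma measurable_test_mean P : measurable_fun [set: n.-tuple (X * Y)] (test_mean P h).
Proof.
exact: (measurable_fun_fubini_tonelli_F (m2 := P)
  (fun Dw => (\int[unif01 R]_xi h (Dw, xi))%E)).
Qed.

Lemma test_mean_ge0 P D : (0 <= test_mean P h D)%E.
Proof. by apply: integral_ge0. Qed.

Lemma integral_fit_law P :
  (\int[fit_law P n]_w h w = \int[iid_law P n]_D test_mean P h D)%E.
Proof.
transitivity (\int[iid_law P n \x P]_Dw \int[unif01 R]_xi h (Dw, xi))%E.
  pose P2 : probability (n.-tuple (X * Y) * (X * Y))%type R :=
    (iid_law P n \x P)%E.
  exact: (fubini_tonelli1 (m1 := P2) (m2 := unif01 R) h mh h0).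
exact: (fubini_tonelli1 (m1 := iid_law P n) (m2 := P)
  (fun Dw => (\int[unif01 R]_xi h (Dw, xi))%E) mseed seed0).
Qed.

Lemma test_mean_le P D (M : R) :
  (forall w xi, h (D, w, xi) <= M%:E)%E -> (test_mean P h D <= M%:E)%E.
Proof.
by move=> hM; apply: integral_le_cst => // w; apply: integral_le_cst.
Qed.

Lemma test_mean_contamination P z (s : R) (s0 : 0 <= s) (s1 : 0 <= 1 - s) D :
  test_mean (contamination P z s0 s1) h D =
  (s%:E * test_mean P h D + (1 - s)%:E * \int[unif01 R]_xi h (D, z, xi))%E.
Proof. by rewrite /test_mean ge0_integral_contamination. Qed.

End test_mean.

Lemma eq_test_mean P n (h h' : fit_space n -> \bar R) D :
  (forall w xi, h (D, w, xi) = h' (D, w, xi)) ->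
  test_mean P h D = test_mean P h' D.
Proof.
by move=> hh'; apply: eq_integral => w _; apply: eq_integral => xi _.
Qed.

Definition plant_fit (z : X * Y) (f : {mfun X >-> Yhat}) A D xi :=
  if z \in D then f else A D xi.

Lemma measurable_plant_fit z f A : measurable [set z] -> forall m,
  measurable_fun setT (fun w : m.-tuple (X * Y) * unitI R * X =>
    plant_fit z f A w.1.1 w.1.2 w.2).
Proof.
move=> mz m; rewrite (_ : (fun _ => _) =
    (fun w : m.-tuple (X * Y) * unitI R * X =>
      if z \in (w.1.1 : seq _) then f w.2 else A w.1.1 w.1.2 w.2)); last first.
  by apply/funext => w; rewrite /plant_fit; case: ifP.
apply: measurable_fun_ifT.
- apply: (measurable_fun_bool true); rewrite setTI.
  rewrite (_ : _ @^-1` _ = (fun w => w.1.1) @^-1` ~` unmarked z m); last first.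
    by apply/seteqP; split => w /=; rewrite /unmarked /=; [move=> ->|move/negP; rewrite negbK].
  rewrite -[X in measurable X]setTI.
  apply: (measurableT_comp measurable_fst measurable_fst) => //.
  by apply: measurableC; exact: measurable_unmarked.
- exact: measurableT_comp.
- exact: measurable_fit.
Qed.

Definition plant z f A (mz : measurable [set z]) : algorithm R X Y Yhat :=
  Algorithm (measurable_plant_fit f A mz).

Section loss.
Variable l : Yhat -> Y -> R.
Hypothesis ml : measurable_fun setT (fun u : Yhat * Y => l u.1 u.2).

Definition fit_loss A n (w : fit_space n) := l (A w.1.1 w.2 w.1.2.1) w.1.2.2.

Definition loo_loss A n (j : 'I_n) (w : fit_space n) :=
  l (A (leave_out w.1.1 j) w.2 w.1.2.1) w.1.2.2.

Lemma measurable_fit_loss A n : measurable_fun setT (@fit_loss A n).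
Proof.
have mA := measurable_fit A (m := n).
apply: (measurableT_comp ml (g := fun w : fit_space n => (A w.1.1 w.2 w.1.2.1, w.1.2.2))).
apply: measurable_fun_pair.
  apply: (measurableT_comp mA (g := fun w : fit_space n => (w.1.1, w.2, w.1.2.1))).
  apply: measurable_fun_pair; first apply: measurable_fun_pair => //.
  + exact: (measurableT_comp measurable_fst measurable_fst).
  + apply: measurableT_comp => //.
    exact: (measurableT_comp measurable_snd measurable_fst).
apply: measurableT_comp => //.
exact: (measurableT_comp measurable_snd measurable_fst).
Qed.

Lemma measurable_loo_loss A n (j : 'I_n) : measurable_fun setT (@loo_loss A n j).
Proof.
(* Leaving out [j] produces lists of one fixed length, so [leave_out] is a map
   into tuples, the form in which fitting is known to be measurable. *)
pose t := in_tuple [seq i <- enum 'I_n | i != j].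
have mA := measurable_fit A (m := size [seq i <- enum 'I_n | i != j]).
apply: (measurableT_comp ml (g := fun w : fit_space n =>
  (A (leave_out w.1.1 j) w.2 w.1.2.1, w.1.2.2))).
apply: measurable_fun_pair.
  apply: (measurableT_comp mA (g := fun w : fit_space n =>
    (map_tuple (tnth w.1.1) t, w.2, w.1.2.1))).
  apply: measurable_fun_pair; first apply: measurable_fun_pair => //.
  + apply/measurable_fun_tnthP => i.
    rewrite (_ : _ \o _ = fun w : fit_space n => tnth w.1.1 (tnth t i)); last first.
      by apply/funext => w /=; rewrite tnth_map.
    apply: (measurableT_comp (measurable_tnth _)).
    exact: (measurableT_comp measurable_fst measurable_fst).
  + apply: measurableT_comp => //.
    exact: (measurableT_comp measurable_snd measurable_fst).
apply: measurableT_comp => //.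
exact: (measurableT_comp measurable_snd measurable_fst).
Qed.

Lemma alg_riskE A P n :
  alg_risk l A P n = (\int[fit_law P n]_w (fit_loss A w)%:E)%E.
Proof. by rewrite /alg_risk unlock. Qed.

End loss.
End fitting.

Section plant.
Context dX dY dF (R : realType) (X : measurableType dX)
  (Y : measurableType dY) (Yhat : measurableType dF).
Variables (B : R) (l : Yhat -> Y -> R).
Hypotheses (ml : measurable_fun setT (fun u : Yhat * Y => l u.1 u.2))
  (hl : forall u y, 0 <= l u y <= B).
Variables (A : algorithm R X Y Yhat) (f : {mfun X >-> Yhat}).
Variables (P : probability (X * Y)%type R) (z : X * Y) (mz : measurable [set z]).
Variables (s : R) (s0 : 0 <= s) (s1 : 0 <= 1 - s) (n : nat).
Notation P' := (contamination P z s0 s1).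
Notation A' := (plant f A mz).
Notation fit_space n := (n.-tuple (X * Y) * (X * Y) * unitI R)%type.

Lemma risk_ge0 g : (0 <= risk l P g)%E.
Proof.
rewrite /risk unlock; apply: integral_ge0 => w _.
by rewrite lee_fin; case/andP: (hl (g w.1) w.2).
Qed.

Lemma risk_le g : (risk l P g <= B%:E)%E.
Proof.
have mg : measurable_fun [set: (X * Y)%type] (fun w => (l (g w.1) w.2)%:E).
  apply/measurable_EFinP.
  apply: (measurableT_comp ml (g := fun w : X * Y => (g w.1, w.2))).
  by apply: measurable_fun_pair => //; exact: measurableT_comp.
rewrite /risk unlock; apply: integral_le_cst => // w;
  by rewrite lee_fin; case/andP: (hl (g w.1) w.2).
Qed.

Lemma risk_fin_num g : risk l P g \is a fin_num.
Proof. by rewrite ge0_fin_numE ?risk_ge0// (le_lt_trans (risk_le g))// ltry. Qed.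

Let mloss (A0 : algorithm R X Y Yhat) (m : nat) :
  measurable_fun [set: fit_space m] (fun w => (fit_loss l A0 w)%:E).
Proof. by apply/measurable_EFinP; exact: measurable_fit_loss. Qed.

Let loss0 (A0 : algorithm R X Y Yhat) m (w : fit_space m) :
  (0 <= (fit_loss l A0 w)%:E)%E.
Proof. by rewrite lee_fin /fit_loss; case/andP: (hl (A0 w.1.1 w.2 w.1.2.1) w.1.2.2). Qed.

Let lossB (A0 : algorithm R X Y Yhat) m (w : fit_space m) :
  ((fit_loss l A0 w)%:E <= B%:E)%E.
Proof. by rewrite lee_fin /fit_loss; case/andP: (hl (A0 w.1.1 w.2 w.1.2.1) w.1.2.2). Qed.

Let B0 : 0 <= B.
Proof. by case/andP: (hl point point) => /le_trans; apply. Qed.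

Lemma alg_risk_ge0 : (0 <= alg_risk l A P n)%E.
Proof. by rewrite alg_riskE; apply: integral_ge0 => w _; exact: loss0. Qed.

Lemma alg_risk_fin_num : alg_risk l A P n \is a fin_num.
Proof.
rewrite ge0_fin_numE ?alg_risk_ge0// alg_riskE.
apply: (@le_lt_trans _ _ B%:E); last by rewrite ltry.
by apply: integral_le_cst => //; exact: mloss.
Qed.

(** With probability [s] the test point comes from [P]. Then the loss is that of
    [A] on unmarked samples, which carry the law of the data of [A] scaled by
    [s ^+ n], and has mean [risk l P f] on the others, whose mass is at least
    [1 - s ^+ n]. The term with [B] is the share of the risk of [A] that may be
    lost on samples marked by [P] itself. *)
Lemma plant_risk_ge :
  ((s * (s ^+ n * (fine (alg_risk l A P n) -
                   B * fine (iid_law P n (~` unmarked z n))) +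
        (1 - s ^+ n) * fine (risk l P f)))%:E <= alg_risk l A' P' n)%E.
Proof.
have mU := measurable_unmarked (n := n) mz.
have mV := measurableC mU.
pose F := test_mean P (fun w : fit_space n => (fit_loss l A w)%:E).
pose F' := test_mean P (fun w : fit_space n => (fit_loss l A' w)%:E).
have mF : measurable_fun [set: n.-tuple (X * Y)] F by exact: measurable_test_mean.
have mF' : measurable_fun [set: n.-tuple (X * Y)] F' by exact: measurable_test_mean.
have F0 D : (0 <= F D)%E by exact: test_mean_ge0.
have F'0 D : (0 <= F' D)%E by exact: test_mean_ge0.
have FB D : (F D <= B%:E)%E by apply: test_mean_le.
have FF' D : unmarked z n D -> F' D = F D.
  move=> /negbTE zD; apply: eq_test_mean => w xi.
  by rewrite /fit_loss /= /plant_fit zD.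
have F'f D : (~` unmarked z n) D -> F' D = risk l P f.
  move=> /negP; rewrite negbK => zD; rewrite /risk unlock; apply: eq_integral => w _.
  rewrite /fit_loss /= /plant_fit zD.
  exact: integral_probability_cst.
set r := fine (risk l P f).
have rE : risk l P f = r%:E by rewrite fineK// risk_fin_num.
have r0 : 0 <= r by rewrite fine_ge0// risk_ge0.
pose G := test_mean P' (fun w : fit_space n => (fit_loss l A' w)%:E).
have mG : measurable_fun [set: n.-tuple (X * Y)] G by exact: measurable_test_mean.
have FG D : (s%:E * F' D <= G D)%E.
  rewrite /G test_mean_contamination// leeDl// mule_ge0//.
  by apply: integral_ge0.
have -> : (alg_risk l A' P' n = \int[iid_law P' n]_D G D)%E.
  by rewrite alg_riskE; exact: integral_fit_law.
have uv : (alg_risk l A P n = \int[iid_law P n]_D F D)%E.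
  by rewrite alg_riskE; exact: integral_fit_law.
have R0fin := alg_risk_fin_num.
rewrite rE in F'f.
clearbody F F' G r; clear rE.
have step1 : (s%:E * \int[iid_law P' n]_D F' D <= \int[iid_law P' n]_D G D)%E.
  rewrite -ge0_integralZl//; apply: ge0_le_integral => //.
  - by move=> D _; rewrite mule_ge0.
  - exact: measurable_funeM.
apply: le_trans step1; rewrite EFinM; apply: lee_wpmul2l => //.
rewrite iid_contamination_split//.
set u := (\int[iid_law P n]_(D in unmarked z n) F D)%E.
rewrite (_ : (\int[_]_(D in unmarked z n) _ = u)%E); last first.
  by apply: eq_integral => D; rewrite inE => /FF'.
rewrite (_ : (\int[_]_(D in ~` unmarked z n) _ =
    r%:E * iid_law P' n (~` unmarked z n))%E); last first.
  by rewrite -integral_cst//; apply: eq_integral => D; rewrite inE => /F'f ->.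
have -> : (iid_law P' n (~` unmarked z n) =
    1 - (s ^+ n)%:E * iid_law P n (unmarked z n))%E.
  by rewrite (probability_setC (iid_law P' n))// iid_contamination_unmarked.
have {}uv : alg_risk l A P n =
    (u + \int[iid_law P n]_(D in ~` unmarked z n) F D)%E.
  rewrite uv /u -ge0_integral_setU// ?setUv//.
  by apply/disj_setPS => D [].
have vB : (\int[iid_law P n]_(D in ~` unmarked z n) F D <=
    B%:E * iid_law P n (~` unmarked z n))%E.
  rewrite -integral_cst//; apply: ge0_le_integral => //.
  by apply: measurable_funTS.
have u0 : (0 <= u)%E by exact: integral_ge0.
have v0 : (0 <= \int[iid_law P n]_(D in ~` unmarked z n) F D)%E.
  exact: integral_ge0.
have ufin : u \is a fin_num.
  rewrite ge0_fin_numE//; apply: le_lt_trans (_ : alg_risk l A P n < +oo)%E.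
    by rewrite uv leeDl.
  by rewrite ltey_eq R0fin.
have vfin : (\int[iid_law P n]_(D in ~` unmarked z n) F D)%E \is a fin_num.
  rewrite ge0_fin_numE//; apply: le_lt_trans (_ : alg_risk l A P n < +oo)%E.
    by rewrite uv leeDr.
  by rewrite ltey_eq R0fin.
have mfin := fin_num_measure (iid_law P n) _ mV.
have pfin := fin_num_measure (iid_law P n) _ mU.
rewrite -(fineK mfin) -EFinM -(fineK vfin) lee_fin in vB.
rewrite uv -(fineK ufin) -(fineK vfin) -(fineK pfin) /=.
rewrite -[leRHS]/(s ^+ n * fine u +
  r * (1 - s ^+ n * fine (iid_law P n (unmarked z n))))%:E lee_fin.
have p1 : fine (iid_law P n (unmarked z n)) <= 1.
  by rewrite -lee_fin fineK// probability_le1.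
have sn0 : 0 <= s ^+ n by exact: exprn_ge0.
apply: lerD.
  apply: ler_wpM2l => //; lra.
by rewrite [leRHS]mulrC; apply: ler_wpM2r => //; rewrite lerD2l lerN2 ler_piMr.
Qed.

Section stability.
Variable q : nat.
Hypothesis q1 : (1 <= q)%N.

Definition loo_gap (A0 : algorithm R X Y Yhat) (j : 'I_n) (w : fit_space n) : R :=
  `|fit_loss l A0 w - loo_loss l A0 j w| `^ q%:R.

Lemma measurable_loo_gap A0 j : measurable_fun [set: fit_space n]
  (fun w => (loo_gap A0 j w)%:E).
Proof.
apply/measurable_EFinP; apply: (measurableT_comp (measurable_powR _)).
apply: measurableT_comp => //; apply: measurable_funB.
  exact: measurable_fit_loss.
exact: measurable_loo_loss.
Qed.

Lemma loo_gap_ge0 A0 j w : 0 <= loo_gap A0 j w.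
Proof. exact: powR_ge0. Qed.

Lemma loo_gap_le A0 j w : loo_gap A0 j w <= B `^ q%:R.
Proof.
apply: ge0_ler_powR; rewrite ?nnegrE//.
rewrite /fit_loss /loo_loss ler_norml.
have := hl (A0 w.1.1 w.2 w.1.2.1) w.1.2.2.
have := hl (A0 (leave_out w.1.1 j) w.2 w.1.2.1) w.1.2.2.
by move=> /andP[? ?] /andP[? ?]; apply/andP; split; lra.
Qed.

(** Moments, unlike [L^q] norms, split additively over events. *)
Lemma stabilityP (A0 : algorithm R X Y Yhat) (Q : probability (X * Y)%type R)
    (gamma : R) : 0 <= gamma ->
  (stability l q A0 Q n <= gamma%:E)%E <->
  forall j, (\int[fit_law Q n]_w (loo_gap A0 j w)%:E <= (gamma `^ q%:R)%:E)%E.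
Proof.
move=> gamma0.
have q0 : (q%:R : R) != 0 by rewrite pnatr_eq0 -lt0n.
have gapE j : (\int[fit_law Q n]_w (loo_gap A0 j w)%:E =
    Lnorm (fit_law Q n) q%:R%:E (fun w =>
      (l (A0 w.1.1 w.2 w.1.2.1) w.1.2.2 -
       l (A0 (leave_out w.1.1 j) w.2 w.1.2.1) w.1.2.2)%:E) `^ q%:R)%E.
  by rewrite poweR_Lnorm.
rewrite /stability; split=> [+ j|H].
  move=> /bigmax_leP [_ /(_ j isT) H]; rewrite gapE -poweR_EFin.
  by apply: gt0_ler_poweR => //; rewrite in_itv /= ?Lnorm_ge0 ?lee_fin ?leey ?andbT.
apply/bigmax_leP; split; first by rewrite lee_fin.
move=> j _.
have rootK (x : \bar R) : (0 <= x -> x = (x `^ q%:R) `^ (q%:R)^-1)%E.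
  by move=> x0; rewrite -poweRrM divff// poweRe1.
rewrite [leLHS]rootK ?Lnorm_ge0// -gapE [leRHS]rootK ?lee_fin// poweR_EFin.
apply: gt0_ler_poweR; rewrite ?in_itv /= ?lee_fin ?leey ?andbT ?powR_ge0//.
  by apply: integral_ge0 => w _; rewrite lee_fin loo_gap_ge0.
Qed.

(** The gap of the planted algorithm is nonzero only in two cases. If the sample
    is unmarked, the gap is that of [A] when the test point comes from [P], and
    at most [B ^ q] when the test point is the marker; this amounts to at most
    [s ^+ n.+1 * G + (1 - s) * s ^+ n * B ^ q]. If exactly the deleted point is
    marked, the gap is at most [B ^ q], with probability at most
    [(s * p + (1 - s)) * s ^+ n.-1], where [p] is the mass [P] gives to the
    marker. If any other point is marked, [f] is returned with and without the
    deleted point. The sum stays below [G] because [1 - s ^+ n.+1] is at least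
    [(1 - s) * (n * s ^+ n.-1 + s ^+ n)], while [G] is at least [2 * B ^ q / n];
    the summand [s ^+ n] leaves room for a positive [p]. *)
Lemma plant_loo_gap (G : R) j :
  2 * B `^ q%:R <= n%:R * G ->
  n%:R * fine (P [set z]) <= 2 * (1 - s) ->
  (\int[fit_law P n]_w (loo_gap A j w)%:E <= G%:E)%E ->
  (\int[fit_law P' n]_w (loo_gap A' j w)%:E <= G%:E)%E.
Proof.
move=> CG pz gapG.
set C := B `^ q%:R in CG.
have C0 : 0 <= C by exact: powR_ge0.
have mU := measurable_unmarked (n := n) mz.
have mV := measurableC mU.
have mgap A0 := measurable_loo_gap A0 j.
have gap0 A0 (w : fit_space n) : (0 <= (loo_gap A0 j w)%:E)%E.
  by rewrite lee_fin loo_gap_ge0.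
have gapC A0 (w : fit_space n) : ((loo_gap A0 j w)%:E <= C%:E)%E.
  by rewrite lee_fin loo_gap_le.
pose F := test_mean P (fun w : fit_space n => (loo_gap A j w)%:E).
pose H := test_mean P' (fun w : fit_space n => (loo_gap A' j w)%:E).
have mF : measurable_fun [set: n.-tuple (X * Y)] F by exact: measurable_test_mean.
have mH : measurable_fun [set: n.-tuple (X * Y)] H by exact: measurable_test_mean.
have F0 D : (0 <= F D)%E by exact: test_mean_ge0.
have H0 D : (0 <= H D)%E by exact: test_mean_ge0.
(* [M] consists of the samples in which exactly the deleted point is marked. *)
pose box i := if i == j then [set z] else ~` [set z].
pose M := [set D : n.-tuple (X * Y) | forall i, box i (tnth D i)].
have mbox i : measurable (box i).
  by rewrite /box; case: ifP => // _; exact: measurableC.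
have mM : measurable M := @measurable_box _ _ n box mbox.
have mem_leave_out (D : n.-tuple (X * Y)) :
    z \in leave_out D j -> exists2 i, i != j & tnth D i = z.
  by move=> /mapP [i]; rewrite mem_filter => /andP[ij _] ->; exists i.
have HU D : unmarked z n D -> (H D <= s%:E * F D + ((1 - s) * C)%:E)%E.
  move=> zD; rewrite /H (@eq_test_mean _ _ _ _ _ _ _ _
      (fun w : fit_space n => (loo_gap A j w)%:E)).
    rewrite test_mean_contamination// leeD2l// EFinM lee_wpmul2l//.
    apply: integral_le_cst => //.
    exact: (measurableT_comp (mgap A) (measurable_pair1 (D, z))).
  move=> w xi; rewrite /loo_gap /fit_loss /loo_loss /= /plant_fit.
  rewrite (negbTE zD) ifN//; apply: contra zD => /mem_leave_out [i _ <-].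
  exact: mem_tnth.
(* On a marked sample outside [M] a marker survives the deletion of point [j],
   so both fits return [f]. *)
have HM D : (~` unmarked z n) D -> (H D <= C%:E * (\1_M D)%:E)%E.
  move=> /negP; rewrite negbK => zD.
  rewrite indicE; have [_|/negP DM] := boolP (D \in M).
    by rewrite mule1; apply: test_mean_le.
  rewrite mule0 (_ : H D = 0%E)//.
  rewrite /H (@eq_test_mean _ _ _ _ _ _ _ _ (cst 0%E)).
    rewrite /test_mean /=.
    by under eq_integral do rewrite integral0; rewrite integral0.
  move=> w xi; rewrite /loo_gap /fit_loss /loo_loss /= /plant_fit zD.
  rewrite ifT ?subrr ?normr0 ?powR0 ?pnatr_eq0 -?lt0n//.
  have /tnthP [i Di] := zD.
  have leave_out_mem i' : i' != j -> tnth D i' \in leave_out D j.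
    by move=> ij; apply: map_f; rewrite mem_filter ij mem_enum.
  have [ij|ij] := eqVneq i j; last by rewrite Di leave_out_mem.
  apply/negPn/negP => zL; apply: DM; rewrite inE => i' /=; rewrite /box.
  case: eqVneq => [->|ij' zi']; first by rewrite -ij /= -Di.
  by move/negP: zL; apply; rewrite -zi' leave_out_mem.
have EH : (\int[fit_law P' n]_w (loo_gap A' j w)%:E =
    \int[iid_law P' n]_D H D)%E by exact: integral_fit_law.
have EF : (\int[fit_law P n]_w (loo_gap A j w)%:E =
    \int[iid_law P n]_D F D)%E by exact: integral_fit_law.
(* Only the bounds [HU] and [HM] on [H] matter from here on. *)
rewrite EF in gapG; rewrite EH; clearbody F H; clear EF EH.
have nE : n = n.-1.+1 by rewrite prednK// (leq_trans _ (ltn_ord j)).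
set p := fine (P [set z]) in pz.
have pE : P [set z] = p%:E by rewrite fineK// fin_num_measure.
have p0 : 0 <= p by rewrite -lee_fin -pE.
have unmG : (\int[iid_law P n]_(D in unmarked z n) H D <=
    (s * G + (1 - s) * C)%:E)%E.
  apply: (@le_trans _ _
      (\int[iid_law P n]_D (s%:E * F D + ((1 - s) * C)%:E))%E).
    apply: (@le_trans _ _ (\int[iid_law P n]_(D in unmarked z n)
        (s%:E * F D + ((1 - s) * C)%:E))%E).
      apply: ge0_le_integral => //.
      - exact: measurable_funTS.
      - by apply: measurable_funTS; apply: emeasurable_funD => //;
          exact: measurable_funeM.
    apply: ge0_subset_integral => //.
    - by apply: emeasurable_funD => //; exact: measurable_funeM.
    - by move=> D _; rewrite adde_ge0// ?mule_ge0// lee_fin mulr_ge0.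
  rewrite ge0_integralD//.
  - rewrite integral_probability_cst.
    by rewrite ge0_integralZl// [leRHS]EFinD leeD2r// EFinM lee_wpmul2l.
  - by move=> D _; rewrite mule_ge0.
  - exact: measurable_funeM.
  - by move=> D _; rewrite lee_fin mulr_ge0.
have PM : (iid_law P' n M <= ((s * p + (1 - s)) * s ^+ n.-1)%:E)%E.
  rewrite iid_law_box// (bigD1 j)//= EFinM; apply: lee_pmul => //.
  - by apply: prode_ge0.
  - by rewrite /box eqxx contaminationE pE diracE mem_set// mule1.
  pose b i := fine (P' (box i)).
  rewrite (eq_bigr (fun i => (b i)%:E)); last first.
    by move=> i _; rewrite fineK// fin_num_measure.
  rewrite prodEFin lee_fin.
  apply: (@le_trans _ _ (\prod_(i < n | i != j) s)).
    apply: ler_prod => i ij; rewrite fine_ge0//=.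
    rewrite -lee_fin fineK ?fin_num_measure// /box (negbTE ij) contaminationE.
    rewrite diracE memNset ?mule0 ?adde0; last by move=> /(_ erefl).
    by rewrite -[leRHS]mule1 lee_wpmul2l// probability_le1//; exact: measurableC.
  by rewrite prodr_const cardC1 card_ord.
have markedG : (\int[iid_law P' n]_(D in ~` unmarked z n) H D <=
    (C * ((s * p + (1 - s)) * s ^+ n.-1))%:E)%E.
  apply: (@le_trans _ _ (\int[iid_law P' n]_D (C%:E * (\1_M D)%:E))%E).
    apply: (@le_trans _ _ (\int[iid_law P' n]_(D in ~` unmarked z n)
        (C%:E * (\1_M D)%:E))%E).
      apply: ge0_le_integral => //.
      - exact: measurable_funTS.
      - apply: measurable_funTS; apply: measurable_funeM.
        by apply/measurable_EFinP; exact: measurable_indic.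
    apply: ge0_subset_integral => //.
    - apply: measurable_funeM.
      by apply/measurable_EFinP; exact: measurable_indic.
    - by move=> D _; rewrite mule_ge0// lee_fin.
  rewrite ge0_integralZl// ?integral_indic// ?setIT.
    by rewrite EFinM lee_wpmul2l.
  by apply/measurable_EFinP; exact: measurable_indic.
rewrite iid_contamination_split//.
apply: (@le_trans _ _ ((s ^+ n)%:E * (s * G + (1 - s) * C)%:E +
    (C * ((s * p + (1 - s)) * s ^+ n.-1))%:E)%E).
  by apply: leeD => //; apply: lee_wpmul2l => //; rewrite lee_fin exprn_ge0.
rewrite -EFinM -EFinD lee_fin.
(* It remains to compare real numbers, after multiplication by [n]. *)
have key := one_minus_exp_ge n.-1 s0 s1.
have sm0 : 0 <= s ^+ n.-1 by exact: exprn_ge0.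
rewrite nE in pz CG *; rewrite exprS [n.-1.+1.-1]/= in key *.
have k0 : 0 < n.-1.+1%:R :> R by rewrite ltr0n.
move: (s ^+ n.-1) (n.-1.+1%:R : R) k0 key pz CG sm0 => x k k0 key pz CG x0.
have sx0 : 0 <= s * x by exact: mulr_ge0.
have csx0 : 0 <= (1 - s) * (s * x) by exact: mulr_ge0.
have kcx0 : 0 <= k * (1 - s) * x by rewrite !mulr_ge0// ltW.
have sx1 : 0 <= s * (1 - s * x) by apply: mulr_ge0 => //; lra.
have W0 : 0 <= 1 - s * (s * x) by lra.
rewrite -(ler_pM2l k0).
have h1 := ler_wpM2r W0 CG.
have h2 : 0 <= C * (1 - s * (s * x) - (k * (1 - s) * x + (1 - s) * (s * x))).
  by apply: mulr_ge0 => //; lra.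
have h3 : 0 <= C * (s * x) * (2 * (1 - s) - k * p).
  by apply: mulr_ge0; [exact: mulr_ge0|lra].
have h4 : 0 <= C * (k * x) * ((1 - s) * (1 - s)).
  by rewrite !mulr_ge0// ltW.
lra.
Qed.
End stability.
End plant.

(** * A test cannot find a remote marker *)

Lemma infinite_prod_inj (X Y : pointedType) :
  infinite_set [set: X] \/ infinite_set [set: Y] ->
  exists z : nat -> X * Y, injective z.
Proof.
have inj (V : pointedType) : infinite_set [set: V] -> exists v : nat -> V, injective v.
  move=> /infiniteP /pcard_injP [v v_inj]; exists v => i j.
  by apply: v_inj; rewrite inE.
case=> /inj [v v_inj]; [exists (fun k => (v k, point))|exists (fun k => (point, v k))];
  by move=> i j [] /v_inj.
Qed.

Lemma eventually_notin (T : eqType) (zs : nat -> T) (D : seq T) :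
  injective zs -> exists K, forall k, (K <= k)%N -> zs k \notin D.
Proof.
move=> zs_inj; elim: D => [|t D [K KD]]; first by exists 0%N.
have [[i zi]|zt] := pselect (exists i, zs i = t); last first.
  exists K => k Kk; rewrite inE negb_or KD// andbT.
  by apply/eqP => zkt; apply: zt; exists k.
exists (maxn K i.+1) => k; rewrite geq_max => /andP[Kk ik].
rewrite inE negb_or KD// andbT -zi; apply: contraTneq ik => /zs_inj ->.
by rewrite ltnn.
Qed.

Section planting.
Context dX dY dF (R : realType) (X : measurableType dX)
  (Y : measurableType dY) (Yhat : measurableType dF).
Variables (A : algorithm R X Y Yhat) (f : {mfun X >-> Yhat}).
Variable z : nat -> X * Y.
Hypotheses (z_inj : injective z) (mz : forall k, measurable [set z k]).
Notation A_ k := (plant f A (mz k)).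

(** The first [r] rounds of the run on [A] query finitely many data sets, and a
    remote marker lies in none of them; so each query gets the same answer, and
    by induction the next query is the same too. *)
Lemma eventually_history (b : procedure R X Y Yhat) D sd r :
  exists K, forall k, (K <= k)%N -> forall r', (r' <= r)%N ->
    history b (A_ k) D sd r' = history b A D sd r'.
Proof.
elim: r => [|r [K IH]].
  by exists 0%N => k _ r'; rewrite leqn0 => /eqP ->.
have [K' KD] := eventually_notin
  (query b r.+1 D (history b A D sd r) (sd r.+1)).1 z_inj.
exists (maxn K K') => k; rewrite geq_max => /andP[Kk K'k] r'.
rewrite leq_eqVlt ltnS => /predU1P[->|r'r]; last exact: IH.
rewrite /= IH//; congr rcons; congr Round.
by rewrite /= /plant_fit (negbTE (KD _ K'k)).
Qed.

(** Runs stop after finitely many rounds. As the histories agree up to the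
    stopping round of the run on [A], the other run stops in the same round. *)
Lemma eventually_same_output (b : procedure R X Y Yhat) T D sd : runs b T ->
  exists K, forall k, (K <= k)%N -> T (A_ k) D sd = T A D sd.
Proof.
move=> bT; have [r [r0 stopA goA ->]] := bT A D sd.
have [K KH] := eventually_history b D sd r.
exists K => k Kk; have [r' [r'0 stopk gok ->]] := bT (A_ k) D sd.
suff rr' : r' = r by rewrite rr' KH.
apply/eqP; rewrite eqn_leq; apply/andP; split.
  rewrite leqNgt; apply/negP => rr'.
  by have := gok r; rewrite r0 rr' KH// stopA => /(_ isT).
rewrite leqNgt; apply/negP => rr'.
by have := goA r'; rewrite r'0 rr' -(KH k _ r')// ?(ltnW rr')// stopk => /(_ isT).
Qed.

End planting.

(** * Acceptance probability of the original algorithm *)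

Section transfer.
Context dX dY dF (R : realType) (X : measurableType dX)
  (Y : measurableType dY) (Yhat : measurableType dF).
Variables (q : nat) (q1 : (1 <= q)%N) (alpha tau B gamma : R) (n N : nat).
Hypothesis n1 : (1 <= n)%N.
Variable l : Yhat -> Y -> R.
Hypotheses (ml : measurable_fun setT (fun u : Yhat * Y => l u.1 u.2))
  (hl : forall u y, 0 <= l u y <= B).
Variables (Q : probability (seeds R) R)
  (T : algorithm R X Y Yhat -> seq (X * Y) -> seeds R -> bool).
Hypothesis hT : black_box_test T.
Hypothesis hgamma : 2 * B / n%:R `^ q%:R^-1 <= gamma.
Hypothesis hvalid : forall (A : algorithm R X Y Yhat)
    (P : probability (X * Y)%type R),
  (stability l q A P n <= gamma%:E)%E ->
  (tau%:E <= alg_risk l A P n)%E ->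
  (prob_accept Q T A P N <= alpha%:E)%E.
Variables (A : algorithm R X Y Yhat) (P : probability (X * Y)%type R).
Hypothesis stabA : (stability l q A P n <= gamma%:E)%E.
Variables (f : {mfun X >-> Yhat}) (z : nat -> X * Y) (s : R).
Hypotheses (z_inj : injective z) (mz : forall k, measurable [set z k]).
Hypotheses (s0 : 0 < s) (s1 : s < 1).
Hypothesis riskf :
  tau < s * (s ^+ n * fine (alg_risk l A P n) +
             (1 - s ^+ n) * fine (risk l P f)).

Let B0 : 0 <= B.
Proof. by case/andP: (hl point point) => /le_trans; apply. Qed.

Let s0' : 0 <= s := ltW s0.
Let s1' : 0 <= 1 - s. Proof. by rewrite subr_ge0 ltW. Qed.
Let A_ k := plant f A (mz k).
Let P_ k := contamination P (z k) s0' s1'.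

Let gamma0 : 0 <= gamma.
Proof. by apply: le_trans hgamma; rewrite divr_ge0 ?mulr_ge0// powR_ge0. Qed.

(** The exponent [q] enters only through [2 <= 2 ^ q]. *)
Lemma gammaq_ge : 2 * B `^ q%:R <= n%:R * gamma `^ q%:R.
Proof.
have n0 : 0 < n%:R :> R by rewrite ltr0n.
have q0 : (q%:R : R) != 0 by rewrite pnatr_eq0 -lt0n.
have nq : 0 < n%:R `^ q%:R^-1 :> R by rewrite powR_gt0.
have : (2 * B) `^ q%:R <= (gamma * n%:R `^ q%:R^-1) `^ q%:R.
  apply: ge0_ler_powR => //; rewrite ?nnegrE ?mulr_ge0// ?powR_ge0//.
  by rewrite -ler_pdivrMr.
rewrite !powRM ?powR_ge0// -[in leRHS]powRrM mulVf// powRr1 ?ler0n//.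
rewrite [leRHS]mulrC; apply: le_trans; apply: ler_wpM2r; first exact: powR_ge0.
rewrite powR_mulrn// -[leLHS]expr1; apply: ler_weXn2l => //.
by rewrite ler1n.
Qed.

(* Remote markers have small mass under [P], as [plant_loo_gap] requires. *)
Let stab_ : \forall k \near \oo, (stability l q (A_ k) (P_ k) n <= gamma%:E)%E.
Proof.
have n0 : 0 < n%:R :> R by rewrite ltr0n.
have d0 : 0 < 2 * (1 - s) / n%:R by rewrite divr_gt0// mulr_gt0// subr_gt0.
have [|K] := @measure_eventually_small _ _ _ P (fun k => [set z k]) mz _ _ d0.
  move=> t; have [K Kt] := eventually_notin [:: t] z_inj.
  by exists K => k /Kt; rewrite inE => + /= tz; rewrite tz eqxx.
move=> _ HK; exists K => // k /HK /= pk.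
apply/stabilityP => // j; apply: plant_loo_gap => //.
- exact: gammaq_ge.
- rewrite mulrC -ler_pdivlMr// -lee_fin fineK//.
  by rewrite fin_num_measure.
- by move/stabilityP : stabA => /(_ q1 gamma0 j).
Qed.

(* The strict inequality [riskf] absorbs the loss of order
   [B * P^n(marked samples)], which vanishes for remote markers. *)
Let risk_ : \forall k \near \oo, (tau%:E <= alg_risk l (A_ k) (P_ k) n)%E.
Proof.
set R0 := fine (alg_risk l A P n).
set r := fine (risk l P f).
have gap0 : 0 < s * (s ^+ n * R0 + (1 - s ^+ n) * r) - tau by rewrite subr_gt0.
pose gap := s * (s ^+ n * R0 + (1 - s ^+ n) * r) - tau.
have e0 : 0 < gap / (B + 1).
  by rewrite divr_gt0// (le_lt_trans B0)// ltrDl.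
have mV k : measurable (~` unmarked (z k) n).
  by apply: measurableC; exact: measurable_unmarked.
have [|K] := @measure_eventually_small _ _ _ (iid_law P n) _ mV _ _ e0.
  move=> D; have [K KD] := eventually_notin D z_inj.
  by exists K => k /KD zD; apply.
move=> _ HK; exists K => // k /HK /= mk.
apply: le_trans (plant_risk_ge ml hl A f P (mz k) s0' s1' n).
rewrite lee_fin -/R0 -/r.
set m := fine _.
have m_le : m <= gap / (B + 1).
  by rewrite -lee_fin fineK// fin_num_measure.
have Bm : B * m <= gap.
  apply: (@le_trans _ _ ((B + 1) * (gap / (B + 1)))); last first.
    by rewrite mulrC divfK// gt_eqF// (le_lt_trans B0)// ltrDl.
  have m0 : 0 <= m by rewrite fine_ge0.
  apply: ler_pM => //; lra.
have sn1 : s * s ^+ n <= 1.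
  by rewrite -exprS exprn_ile1// ltW.
have Bm0 : 0 <= B * m by rewrite mulr_ge0// fine_ge0.
have h : 0 <= (1 - s * s ^+ n) * (B * m) by rewrite mulr_ge0// subr_ge0.
rewrite /gap in Bm; lra.
Qed.

(** Validity bounds the acceptance probability of the planted pair. Restricting
    it to unmarked samples on which both algorithms get the same verdict, and
    using that the two sample laws are there proportional with factor
    [s ^+ N], bounds the acceptance probability of [A] except on an event that
    vanishes for remote markers. *)
Lemma planted_power : ((s ^+ N)%:E * prob_accept Q T A P N <= alpha%:E)%E.
Proof.
have [[b bT] mT] := hT.
pose acc (A0 : algorithm R X Y Yhat) :=
  [set w : N.-tuple (X * Y) * seeds R | T A0 w.1 w.2 = true].
have macc A0 : measurable (acc A0).
  by have := mT A0 N measurableT [set true]; rewrite setTI; exact.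
have mUk k : measurable (unmarked (z k) N `*` [set: seeds R]).
  by apply: measurableX => //; exact: measurable_unmarked.
pose E k := acc A `\` (acc (A_ k) `&` (unmarked (z k) N `*` setT)).
have mE k : measurable (E k) by apply: measurableD => //; exact: measurableI.
apply/lee_addgt0Pr => e e0.
pose mu : probability (N.-tuple (X * Y) * seeds R)%type R :=
  (iid_law P N \x Q)%E.
have [|K] := @measure_eventually_small _ _ _ mu E mE _ _ e0.
  move=> [D sd].
  have [K KT] := eventually_same_output A f z_inj mz D sd bT.
  have [K' KD] := eventually_notin D z_inj.
  exists (maxn K K') => k; rewrite geq_max => /andP[Kk K'k] [/= TD].
  apply; split; last by split => //; exact: KD.
  by rewrite /acc /= /A_ KT.
move=> _ HK.
have [k [Kk stabk riskk]] : exists k,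
   [/\ (K <= k)%N, (stability l q (A_ k) (P_ k) n <= gamma%:E)%E &
    (tau%:E <= alg_risk l (A_ k) (P_ k) n)%E].
  have [K1 _ H1] := stab_; have [K2 _ H2] := risk_.
  exists (maxn K (maxn K1 K2)); split; first exact: leq_maxl.
    by apply: H1; rewrite /= maxnCA leq_maxl.
  by apply: H2; rewrite /= maxnA leq_maxr.
have := hvalid stabk riskk; rewrite /prob_accept => valid.
have sN0 : 0 <= s ^+ N by exact: exprn_ge0.
have ge := prod_contamination_ge P Q s0' s1' (mz k) (macc (A_ k)).
apply: (@le_trans _ _ ((s ^+ N)%:E * ((iid_law P N \x Q)
    (acc (A_ k) `&` (unmarked (z k) N `*` setT)) + e%:E))%E).
  apply: lee_wpmul2l; first by rewrite lee_fin.
  apply: (@le_trans _ _ ((iid_law P N \x Q)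
     ((acc (A_ k) `&` (unmarked (z k) N `*` setT)) `|` E k))%E).
    apply: (le_measure mu); rewrite ?inE//; first exact: macc.
      by apply: measurableU => //; exact: measurableI.
    move=> w Aw; have [?|?] := pselect
      ((acc (A_ k) `&` (unmarked (z k) N `*` setT)) w); [by left|by right].
  apply: le_trans (measureU2 _ _ _) _ => //; first exact: measurableI.
  by rewrite leeD2l//; exact: HK.
rewrite muleDr ?ge0_adde_def ?inE ?lee_fin ?(ltW e0)//.
apply: leeD.
  exact: le_trans ge valid.
by rewrite -EFinM lee_fin ler_piMl ?(ltW e0)// exprn_ile1// ltW.
Qed.

End transfer.

Theorem theorem4 (R : realType) (dX dY dF : measure_display)
    (X : measurableType dX) (Y : measurableType dY) (Yhat : measurableType dF)
    (q : nat) (hq : q = 1%N \/ q = 2%N)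
    (alpha tau B gamma : R) (n N : nat)
    (halpha : 0 < alpha < 1) (htau : 0 < tau)
    (hn : (1 <= n)%N) (hN : (1 <= N)%N)
    (hsing : forall z : X * Y, measurable [set z])
    (hinf : infinite_set [set: X] \/ infinite_set [set: Y])
    (l : Yhat -> Y -> R)
    (ml : measurable_fun setT (fun u : Yhat * Y => l u.1 u.2))
    (hl : forall u y, 0 <= l u y <= B)
    (Q : probability (seeds R) R) (hQ : iid_uniform Q)
    (T : algorithm R X Y Yhat -> seq (X * Y) -> seeds R -> bool)
    (hT : black_box_test T)
    (hgamma : 2 * B / n%:R `^ q%:R^-1 <= gamma)
    (hvalid : forall (A : algorithm R X Y Yhat)
        (P : probability (X * Y)%type R),
      (stability l q A P n <= gamma%:E)%E ->
      (tau%:E <= alg_risk l A P n)%E ->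
      (prob_accept Q T A P N <= alpha%:E)%E) :
  let tau' := tau * (1 + (alpha^-1 - 1) / N%:R) in
  forall (A : algorithm R X Y Yhat) (P : probability (X * Y)%type R),
    (stability l q A P n <= gamma%:E)%E ->
    (alg_risk l A P n < tau%:E)%E ->
    (tau'%:E < max_risk l P)%E ->
    (prob_accept Q T A P N <=
      (Num.min (alpha * (1 + (tau' - fine (alg_risk l A P n)) /
                             (fine (max_risk l P) - tau')) `^ (N%:R / n%:R))
               1)%:E)%E.
Proof.
move=> tau' A P stabA riskA tau'_lt.
have q1 : (1 <= q)%N by case: hq => ->.
have /andP[a0 a1] := halpha.
have [z z_inj] := infinite_prod_inj hinf.
have max_fin : max_risk l P \is a fin_num.
  rewrite fin_numElt (lt_trans _ tau'_lt) ?ltNyr//=.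
  apply: (@le_lt_trans _ _ B%:E); last by rewrite ltry.
  apply: ge_ereal_sup => _ [g _ <-].
  exact: risk_le.
have RA_fin := alg_risk_fin_num ml hl A P n.
set RA := fine (alg_risk l A P n); set RM := fine (max_risk l P).
have RAE : alg_risk l A P n = RA%:E by rewrite fineK.
have RME : max_risk l P = RM%:E by rewrite fineK.
rewrite RAE lte_fin in riskA; rewrite RME lte_fin in tau'_lt.
have tau_le : tau <= tau'.
  apply: ler_peMr; first exact: ltW.
  by rewrite lerDl divr_ge0// subr_ge0 invf_ge1// ltW.
pose mu : probability (N.-tuple (X * Y) * seeds R)%type R :=
  (iid_law P N \x Q)%E.
have macc : measurable
    [set w : N.-tuple (X * Y) * seeds R | T A w.1 w.2 = true].
  by have := hT.2 A N measurableT [set true]; rewrite setTI; exact.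
have acc0 : (0 <= prob_accept Q T A P N)%E by exact: (measure_ge0 mu).
have acc1 : (prob_accept Q T A P N <= 1)%E by exact: (probability_le1 mu).
set pr := fine (prob_accept Q T A P N).
have prE : prob_accept Q T A P N = pr%:E.
  by rewrite fineK// ge0_fin_numE// (le_lt_trans acc1)// ltry.
have pr1 : pr <= 1 by rewrite -lee_fin -prE.
rewrite prE lee_fin le_min pr1 andbT.
have n0 : 0 < n%:R :> R by rewrite ltr0n.
(* For [s ^+ n = p] the mixture [s ^+ n * RA + (1 - s ^+ n) * RM] equals
   [tau']. *)
pose p := (RM - tau') / (RM - RA).
have RMA : 0 < RM - RA by lra.
have p0 : 0 < p by rewrite divr_gt0// subr_gt0.
have p1 : p < 1 by rewrite ltr_pdivrMr// mul1r; lra.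
have pE : p * (RM - RA) = RM - tau' by rewrite divfK// gt_eqF.
pose c := p `^ n%:R^-1.
have c0 : 0 < c by rewrite powR_gt0.
have cn : c ^+ n = p.
  by rewrite -powR_mulrn ?powR_ge0// -powRrM mulVf ?gt_eqF// powRr1// ltW.
have cN : c ^+ N = p `^ (N%:R / n%:R).
  by rewrite -powR_mulrn ?powR_ge0// -powRrM mulrC.
have key s : 0 < s -> s < c -> s ^+ N * pr <= alpha.
  move=> s0 sc.
  have snp : s ^+ n < p by rewrite -cn ltrXn2r// -?lt0n// ltW.
  have sn0 : 0 < s ^+ n by exact: exprn_gt0.
  have s1 : s < 1.
    rewrite ltNge; apply/negP => /(exprn_ege1 n); lra.
  have [small|large] := ltP (s * tau') tau.
    apply: (@le_trans _ _ (s ^+ N)); last exact: expr_le_below_inflation small.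
    by rewrite ler_piMr// exprn_ge0// ltW.
  have sn1 : 0 < 1 - s ^+ n by lra.
  have mix_gt : tau' - s ^+ n * RA < (1 - s ^+ n) * RM.
    have := ltr_pM2r RMA (s ^+ n) p; rewrite snp pE => /esym; lra.
  have : (((tau' - s ^+ n * RA) / (1 - s ^+ n))%:E < max_risk l P)%E.
    by rewrite RME lte_fin ltr_pdivrMr// [ltRHS]mulrC.
  move=> /ereal_sup_gt [_ [f _ <-] riskf].
  have := risk_fin_num ml hl P f => /fineK rE.
  rewrite -rE lte_fin ltr_pdivrMr// in riskf.
  rewrite -lee_fin EFinM -prE.
  apply: (planted_power q1 hn ml hl hT hgamma hvalid stabA (f := f) z_inj) => //.
  apply: le_lt_trans large _; rewrite ltr_pM2l// -/RA; lra.
have := le_exp_limit (ltW a0) c0 key; rewrite cN => bound.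
set x := N%:R / n%:R in bound *.
have -> : 1 + (tau' - RA) / (RM - tau') = p^-1.
  have d0 : RM - tau' != 0 by rewrite subr_eq0 gt_eqF.
  by rewrite /p invf_div -[X in X + _](divff d0) -mulrDl addrA subrK.
have px0 : 0 < p `^ x by rewrite powR_gt0.
have pxV : p^-1 `^ x * p `^ x = 1.
  by rewrite -powRM ?invr_ge0 ?ltW// mulVf ?gt_eqF// powR1.
rewrite -(ler_pM2l px0); apply: le_trans bound _.
by rewrite mulrCA [p `^ x * _]mulrC pxV mulr1.
Qed.
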